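(* Let $w\geq 4$ be an integer that is not a perfect square. Then the set of radical points of the conic $C(w)$ is $$E(w)=\{(a_{n+1}(w),a_n(w))\in C(w): n\in \mathbb{N}\}.$$
   Context: Here $\mathbb{N}=\{0,1,2,\dots\}$. For an integer $w\geq 4$, the generalized Matiyasevich conic is $C(w)=\{(x,y)\in\mathbb{R}^2: x^2-\sqrt{w}\,xy+y^2=1\}$. Its set of radical points is $E(w)=L(w)\cup R(w)$, where $L(w)=\{(u\sqrt{w},v)\in C(w): u,v\in\mathbb{N},\ u\sqrt{w}>v\}$ and $R(w)=\{(u,v\sqrt{w})\in C(w): u,v\in\mathbb{N},\ u>v\sqrt{w}\}$. The sequence $(a_n(w))_{n\geq 0}$ is defined by $a_0(w)=0$, $a_1(w)=1$ and $a_{n+1}(w)=\sqrt{w}\,a_n(w)-a_{n-1}(w)$ for $n\geq1$ (characteristic polynomial $t^2-\sqrt{w}t+1$). *)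

(* Defs.v *)
From mathcomp Require Import all_boot all_order all_algebra.
From mathcomp Require Import classical_sets reals.

Set Implicit Arguments.
Unset Strict Implicit.
Unset Printing Implicit Defensive.

Import Order.TTheory GRing.Theory Num.Theory.
Local Open Scope classical_set_scope.
Local Open Scope ring_scope.

Definition sqrtw (R : realType) (w : nat) : R := Num.sqrt w%:R.

Definition conic (R : realType) (w : nat) : set (R * R) :=
  [set p | p.1 ^+ 2 - sqrtw R w * p.1 * p.2 + p.2 ^+ 2 = 1].
Arguments conic R w : clear implicits.

Definition radicalL (R : realType) (w : nat) : set (R * R) :=
  [set p | conic R w p /\
     exists u v : nat, p = (u%:R * sqrtw R w, v%:R) /\
                       v%:R < u%:R * sqrtw R w].
Arguments radicalL R w : clear implicits.

Definition radicalR (R : realType) (w : nat) : set (R * R) :=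
  [set p | conic R w p /\
     exists u v : nat, p = (u%:R, v%:R * sqrtw R w) /\
                       v%:R * sqrtw R w < u%:R].
Arguments radicalR R w : clear implicits.

Definition radical_points (R : realType) (w : nat) : set (R * R) :=
  radicalL R w `|` radicalR R w.
Arguments radical_points R w : clear implicits.

Fixpoint aseq (R : realType) (w n : nat) : R :=
  match n with
  | 0%N => 0
  | 1%N => 1
  | (m.+1 as k).+1 => sqrtw R w * aseq R w k - aseq R w m
  end.

(* Main.v *)
(** The map [(x, y) |-> (s * x - y, x)], with [s] the square root of [w],
    preserves the conic and exchanges its points [(u * s, v)] and
    [(u, v * s)].  It sends the radical point [(1, 0)] through the pairs of
    consecutive terms of the sequence.  Conversely, the inverse map
    [(x, y) |-> (y, s * y - x)] keeps a radical point with [y <> 0] radical, and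
    strictly decreases the natural number [y ^ 2], so every radical point
    descends to one with [y = 0], which can only be [(1, 0)]. *)

Require Import Defs.
From mathcomp Require Import all_boot all_order all_algebra.
From mathcomp Require Import classical_sets reals.
From mathcomp Require Import ring lra.

Import Order.TTheory GRing.Theory Num.Theory.
Local Open Scope classical_set_scope.
Local Open Scope ring_scope.

Lemma sqr_sqrtw (R : realType) (w : nat) : sqrtw R w ^+ 2 = w%:R.
Proof. by rewrite /sqrtw sqr_sqrtr. Qed.

Lemma sqrtw_ge2 (R : realType) (w : nat) : (4 <= w)%N -> 2 <= sqrtw R w.
Proof.
move=> hw; have s0 : 0 <= sqrtw R w by exact: sqrtr_ge0.
by rewrite -ler_sqr ?nnegrE // sqr_sqrtw -natrX ler_nat.
Qed.

Lemma conic_up (R : realType) (w : nat) (x y : R) :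
  conic R w (x, y) -> conic R w (sqrtw R w * x - y, x).
Proof. by rewrite /conic /= => <-; ring. Qed.

Lemma conic_down (R : realType) (w : nat) (x y : R) :
  conic R w (x, y) -> conic R w (y, sqrtw R w * y - x).
Proof. by rewrite /conic /= => <-; ring. Qed.

Lemma radical_points_conic (R : realType) (w : nat) (p : R * R) :
  radical_points R w p -> conic R w p.
Proof. by case=> [[]|[]]. Qed.

Lemma radical_points_lt (R : realType) (w : nat) (x y : R) :
  radical_points R w (x, y) -> 0 <= y < x.
Proof.
have s0 : 0 <= sqrtw R w by exact: sqrtr_ge0.
by case=> [[_ [u [v [[-> ->] ->]]]]|[_ [u [v [[-> ->] ->]]]]];
  rewrite ?mulr_ge0 ?ler0n.
Qed.

(** [y] may be [v * s], which need not be an integer; its square [v ^ 2 * w] is one, and so can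
    measure the descent. *)
Lemma radical_points_sqr_nat (R : realType) (w : nat) (x y : R) :
  radical_points R w (x, y) -> exists n : nat, y ^+ 2 = n%:R.
Proof.
case=> [[_ [u [v [[_ ->] _]]]]|[_ [u [v [[_ ->] _]]]]].
- by exists (v ^ 2)%N; rewrite natrX.
- by exists (v ^ 2 * w)%N; rewrite natrM natrX exprMn sqr_sqrtw.
Qed.

Lemma radical_points_base (R : realType) (w : nat) :
  radical_points R w (1, 0).
Proof.
right; split; first by rewrite /conic /=; ring.
by exists 1%N, 0%N; rewrite mul0r ltr01.
Qed.

Lemma radical_points_up (R : realType) (w : nat) (x y : R) : (4 <= w)%N ->
  radical_points R w (x, y) ->
  radical_points R w (sqrtw R w * x - y, x).
Proof.
move=> hw rxy; have s2 := sqrtw_ge2 R w hw; have ss := sqr_sqrtw R w.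
have C := conic_up _ _ _ _ (radical_points_conic _ _ _ rxy).
have /andP[y0 yx] := radical_points_lt _ _ _ _ rxy.
(* From [s >= 2] and [0 <= y < x]: [s * x - y >= 2 * x - y > x]. *)
have lt_up : x < sqrtw R w * x - y by nra.
case: rxy C y0 yx lt_up.
- case=> _ [u [v [[-> ->] _]]] C v0 vu lt_up; right; split=> //.
  (* Subtraction in [nat] truncates, so the witness [u * w - v] needs this bound, which follows from
     [v < u * s] and [s >= 2]. *)
  have le_v : (v <= u * w)%N by rewrite -(ler_nat R) natrM -ss; nra.
  exists (u * w - v)%N, u; rewrite natrB // natrM -ss.
  have E : sqrtw R w * (u%:R * sqrtw R w) - v%:R
         = u%:R * sqrtw R w ^+ 2 - v%:R by ring.
  by rewrite -E.
- case=> _ [u [v [[-> ->] _]]] C v0 vu lt_up; left; split=> //.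
  have v_ge0 : 0 <= v%:R :> R by exact: ler0n.
  have le_v : (v <= u)%N by rewrite -(ler_nat R); nra.
  exists (u - v)%N, u; rewrite natrB //.
  have E : sqrtw R w * u%:R - v%:R * sqrtw R w
         = (u%:R - v%:R) * sqrtw R w by ring.
  by rewrite -E.
Qed.

(** Integrality enters here: [y ^ 2] is a nonzero natural number, so [x * z = y ^ 2 - 1 >= 0] and
    [z >= 0]. Also [x * z < y ^ 2 < x * y], hence [z < y]. *)
Lemma radical_points_down (R : realType) (w : nat) (x y : R) : (4 <= w)%N ->
  radical_points R w (x, y) -> y != 0 ->
  radical_points R w (y, sqrtw R w * y - x).
Proof.
move=> hw rxy yN0; have s2 := sqrtw_ge2 R w hw; have ss := sqr_sqrtw R w.
have conic_xy := radical_points_conic _ _ _ rxy.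
have C := conic_down _ _ _ _ conic_xy.
have /andP[y0 yx] := radical_points_lt _ _ _ _ rxy.
have y_gt0 : 0 < y by rewrite lt_def yN0.
have y_sq_ge1 : 1 <= y ^+ 2.
  have [n yn] := radical_points_sqr_nat _ _ _ _ rxy.
  by rewrite yn ler1n -(ltr_nat R) -yn exprn_gt0.
(* The conic equation reads [x * z = y ^ 2 - 1] for [z = s * y - x]. *)
have z_eq : x * (sqrtw R w * y - x) = y ^+ 2 - 1.
  by rewrite -conic_xy /=; ring.
have x_gt0 : 0 < x by lra.
have z_ge0 : 0 <= sqrtw R w * y - x.
  by rewrite -(pmulr_rge0 _ x_gt0) z_eq subr_ge0.
have z_lt : sqrtw R w * y - x < y.
  by rewrite -(ltr_pM2l x_gt0) z_eq; nra.
case: rxy C z_ge0 z_lt.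
- case=> _ [u [v [[-> ->] _]]] C z_ge0 z_lt; right; split=> //.
  have E : sqrtw R w * v%:R - u%:R * sqrtw R w
         = (v%:R - u%:R) * sqrtw R w by ring.
  (* By [E], [z >= 0] reads [(v - u) * s >= 0], so the difference [v - u] is exact in [nat]. *)
  have le_u : (u <= v)%N by rewrite -(ler_nat R); nra.
  by exists v, (v - u)%N; rewrite natrB // -E.
- case=> _ [u [v [[-> ->] _]]] C z_ge0 z_lt; left; split=> //.
  have E : sqrtw R w * (v%:R * sqrtw R w) - u%:R = v%:R * w%:R - u%:R.
    by rewrite -ss; ring.
  have le_u : (u <= v * w)%N by rewrite -(ler_nat R) natrM -subr_ge0 -E.
  by exists v, (v * w - u)%N; rewrite natrB // natrM -E.
Qed.

Lemma aseq_radical_points (R : realType) (w n : nat) : (4 <= w)%N ->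
  radical_points R w (aseq R w n.+1, aseq R w n).
Proof.
move=> hw; elim: n => [|n IHn]; first exact: radical_points_base.
(* By the recurrence, the next pair is convertible to the image of the current pair. *)
exact: radical_points_up.
Qed.

Lemma radical_points_aseq (R : realType) (w : nat) (x y : R) : (4 <= w)%N ->
  radical_points R w (x, y) ->
  exists n : nat, (aseq R w n.+1, aseq R w n) = (x, y).
Proof.
move=> hw rxy; have [m ym] := radical_points_sqr_nat _ _ _ _ rxy.
elim/ltn_ind: m x y rxy ym => m IHm x y rxy ym.
have /andP[y0 yx] := radical_points_lt _ _ _ _ rxy.
have [yE|yN0] := eqVneq y 0.
  (* At [y = 0] the conic reads [x ^ 2 = 1], and [y < x] selects the root [x = 1]. *)
  exists 0%N; have := radical_points_conic _ _ _ rxy.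
  rewrite /conic yE /= mulr0 subr0 expr0n addr0 => x_sq.
  by congr (_, _); rewrite yE in yx; nra.
have rdown := radical_points_down _ _ _ _ hw rxy yN0.
have [k zk] := radical_points_sqr_nat _ _ _ _ rdown.
have /andP[z0 zy] := radical_points_lt _ _ _ _ rdown.
have lt_km : (k < m)%N by rewrite -(ltr_nat R) -zk -ym ltr_sqr ?nnegrE.
have [n azy] := IHm k lt_km _ _ rdown zk.
have ay : aseq R w n.+1 = y := congr1 fst azy.
have az : aseq R w n = sqrtw R w * y - x := congr1 snd azy.
(* Going back up costs one index: the recurrence gives [s * y - (s * y - x) = x]. *)
exists n.+1; congr (_, _); last exact: ay.
have -> : aseq R w n.+2 = sqrtw R w * aseq R w n.+1 - aseq R w n by [].
by rewrite ay az subKr.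
Qed.

Theorem theorem1 (R : realType) (w : nat) (hw : (4 <= w)%N)
    (hsq : ~ exists k : nat, w = (k ^ 2)%N) :
  (forall n : nat, conic R w (aseq R w n.+1, aseq R w n)) /\
  radical_points R w = [set (aseq R w n.+1, aseq R w n) | n in [set: nat]].
Proof.
split=> [n|].
  exact: radical_points_conic _ _ _ (aseq_radical_points R w n hw).
apply/seteqP; split=> [[x y] rxy | _ [n _ <-]].
  by have [n <-] := radical_points_aseq _ _ _ _ hw rxy; exists n.
exact: aseq_radical_points.
Qed.
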